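(* Let $r_0, r_1, r_2$ be positive integers and let $P\in NM(r_0,r_1,r_2,r_0)$, i.e. $P$ is a normalized matching poset of rank $3$ with rank numbers $(r_0,r_1,r_2,r_0)$. If both $r_1$ and $r_0$ divide $r_2-1$, then $P$ is nested.
   Context: All posets are finite. A chain in a poset is a (nonempty) totally ordered subset; $|C|$ denotes the number of elements of a chain $C$. Chains are not required to be saturated (they may skip ranks). A chain decomposition of a poset $P$ is a collection $\mathcal{C}$ of pairwise disjoint chains of $P$ whose union is $P$. A graded poset is a poset in which all maximal chains have the same length. Its rank function $r:P\to\mathbb{N}$ is defined by $r(x)=i$ if there are exactly $i$ elements $y<x$ in a maximal chain containing $x$. The rank of $P$ is $\max_{x\in P} r(x)$. The $i$th level is $L_i=\{x\in P : r(x)=i\}$, and $r_i=|L_i|$. The rank numbers of a graded poset of rank $n$ are the sequence $(r_0,r_1,\ldots,r_n)$. For levels $L_i, L_j$ and $S\subseteq L_i$, put $\Gamma_j(S)=\{x\in L_j : x\le y \text{ or } y\le x \text{ for some } y\in S\}$. The graded poset $P$ is a normalized matching poset if for all levels $L_i,L_j$ and all $S\subseteq L_i$, $$\frac{|S|}{r_i}\le \frac{|\Gamma_j(S)|}{r_j}.$$ $NM(r_0,r_1,\ldots,r_n)$ denotes the collection of all normalized matching posets of rank $n$ with rank numbers $(r_0,r_1,\ldots,r_n)$. A chain decomposition $\mathcal{C}$ of a graded poset $P$ is a nested chain decomposition (a nesting) if for any chains $C_i,C_j\in\mathcal{C}$, $|C_i|\le|C_j|$ implies $\{r(x): x\in C_i\}\subseteq\{r(x):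 x\in C_j\}$, where $r(x)$ is the rank of $x$ in $P$. The poset $P$ is nested if it has a nesting. *)

(* Defs.v *)
From mathcomp Require Import all_boot all_order all_algebra.

Set Implicit Arguments.
Unset Strict Implicit.
Unset Printing Implicit Defensive.

Import Order.TTheory.

Section GradedPosets.
Variables (d : Order.disp_t) (T : finPOrderType d).
Implicit Types (x y : T) (C D S : {set T}) (CC : {set {set T}}).

Definition chain C : bool :=
  (C != set0) && [forall x in C, forall y in C, (x >=< y)%O].

Definition max_chain C : bool := maxset chain C.

Definition graded : Prop :=
  forall C D, max_chain C -> max_chain D -> #|C| = #|D|.

(* The maximal chain through x is chosen arbitrarily; when the poset is graded
   the choice is irrelevant, see [rankE]. *)
Definition rank x : nat :=
  if [pick C : {set T} | max_chain C && (x \in C)] is Some C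
  then #|[set y in C | (y < x)%O]| else 0.

Lemma chainP C :
  reflect (C != set0 /\ {in C &, forall x y, (x >=< y)%O}) (chain C).
Proof.
apply: (iffP andP) => -[C0 h]; split=> //.
  by move=> x y xC yC; move/forall_inP/(_ x xC)/forall_inP: h; apply.
by apply/forall_inP=> x xC; apply/forall_inP=> y yC; apply: h.
Qed.

Lemma max_chain_mem C z :
  max_chain C -> {in C, forall y, (z >=< y)%O} -> z \in C.
Proof.
case/maxsetP=> /chainP[_ cC] mC zC.
rewrite -(mC (z |: C)) ?setU11 ?subsetU1 //; apply/chainP; split.
  by apply/set0Pn; exists z; rewrite setU11.
move=> u v /setU1P[->|uC] /setU1P[->|vC]; rewrite ?comparablexx //.
- exact: zC.
- by rewrite comparable_sym zC.
- exact: cC.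
Qed.

Lemma rankE x C :
  graded -> max_chain C -> x \in C -> rank x = #|[set y in C | (y < x)%O]|.
Proof.
move=> gP mC xC; rewrite /rank; case: pickP => [D /andP[mD xD]|/(_ C)]; last first.
  by rewrite mC xC.
have [/chainP[_ cC] _] := maxsetP mC; have [/chainP[_ cD] _] := maxsetP mD.
pose lo := [set y in D | (y < x)%O]; pose hi := [set y in C | (x <= y)%O].
have cmp u v : u \in lo -> v \in hi -> (u >=< v)%O.
  rewrite !inE => /andP[_ ux] /andP[_ xv].
  by apply: le_comparable; exact: le_trans (ltW ux) xv.
have cE : chain (lo :|: hi).
  apply/chainP; split.
    by apply/set0Pn; exists x; rewrite !inE xC lexx orbT.
  move=> u v /setUP[ul|uh] /setUP[vl|vh]; last 1 first.
  - by move: uh vh; rewrite !inE => /andP[? _] /andP[? _]; apply: cC.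
  - by move: ul vl; rewrite !inE => /andP[? _] /andP[? _]; apply: cD.
  - exact: cmp.
  - by rewrite comparable_sym cmp.
have mE : max_chain (lo :|: hi).
  apply/maxsetP; split=> // F /chainP[_ cF] sEF.
  apply/eqP; rewrite eqEsubset sEF andbT; apply/subsetP=> z zF.
  have xF : x \in F by apply: (subsetP sEF); rewrite !inE xC lexx orbT.
  have zx := cF _ _ zF xF.
  have zE u : u \in lo :|: hi -> (z >=< u)%O.
    by move=> uE; apply: cF => //; apply: (subsetP sEF).
  have [/= xz|zltx] : (x <= z)%O \/ (z < x)%O.
  - by case: (comparable_leP zx) (zx) => [zlex _|xz _]; [move: zlex;
      rewrite le_eqVlt => /orP[/eqP->|]; [left|right] | left; apply: ltW].
  - rewrite !inE xz andbT; apply/orP; right; apply: max_chain_mem => // y yC.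
    have := cC _ _ yC xC; case/orP=> [yx|xy].
      by rewrite comparable_sym; apply: le_comparable; apply: le_trans yx xz.
    by apply: zE; rewrite !inE yC xy orbT.
  - rewrite !inE zltx andbT; apply/orP; left; apply: max_chain_mem => // y yD.
    have [xy|] := boolP (x <= y)%O.
      by apply: le_comparable; apply: le_trans (ltW zltx) xy.
    have := cD _ _ yD xD; case/orP=> [yx xy|->//].
    apply: zE; rewrite !inE yD lt_neqAle yx andbT.
    by case: eqP xy => // ->; rewrite lexx.
have := gP _ _ mE mC; rewrite cardsU.
have -> : lo :&: hi = set0.
  apply/setP=> y; rewrite !inE; apply/negP=> /andP[/andP[_ yx] /andP[_ xy]].
  by have := lt_le_trans yx xy; rewrite ltxx.
rewrite cards0 subn0 -(cardsID hi C).
have -> : C :&: hi = hi by apply/setP=> y; rewrite !inE; case: (y \in C).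
have -> : C :\: hi = [set y in C | (y < x)%O].
  apply/setP=> y; rewrite !inE andbC; case yC: (y \in C) => //=.
  have := cC _ _ yC xC; case/orP=> h.
    by rewrite lt_neqAle h andbT eq_le h.
  by rewrite h /=; apply/esym/negP=> /lt_le_trans/(_ h); rewrite ltxx.
by rewrite addnC => /addnI.
Qed.

Definition poset_rank : nat := \max_(x : T) rank x.

Definition level (i : nat) : {set T} := [set x | rank x == i].

Definition Gamma (j : nat) S : {set T} :=
  [set x in level j | [exists y in S, (x <= y)%O || (y <= x)%O]].

Definition normalized_matching : Prop :=
  forall i j : nat, i <= poset_rank -> j <= poset_rank ->
  forall S, S \subset level i ->
    (#|S|%:Q / #|level i|%:Q <= #|Gamma j S|%:Q / #|level j|%:Q)%R.

Definition rank_numbers : seq nat :=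
  [seq #|level i| | i <- iota 0 poset_rank.+1].

Definition NM (r : seq nat) : Prop :=
  [/\ graded, normalized_matching & rank_numbers = r].

(* [partition] also requires set0 \notin CC, which [chain] implies anyway. *)
Definition chain_decomposition CC : Prop :=
  partition CC [set: T] /\ {in CC, forall C, chain C}.

Definition nesting CC : Prop :=
  chain_decomposition CC /\
  {in CC &, forall C D, #|C| <= #|D| ->
    {subset [seq rank x | x in C] <= [seq rank x | x in D]}}.

Definition nested : Prop := exists CC, nesting CC.

End GradedPosets.

Arguments graded {d} T.
Arguments poset_rank {d} T.
Arguments normalized_matching {d} T.
Arguments rank_numbers {d} T.
Arguments NM {d} T r.
Arguments nested {d} T.

(* Main.v *)
(* Let r2 = a r1 + 1 = b r0 + 1 with a, b > 0 and fix z in L_2.  The extra [+ 1]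
   makes normalized matching strict enough that z can be discarded: every S in
   L_1 has at least a|S| neighbours in L_2 - z, and every S in L_0 or L_3 at
   least b|S|.  If r0 <= r1, Hall's theorem splits L_2 - z into r1 stars of size
   a centred in L_1; if r1 <= r0, into r0 stars of size b centred in L_3.  As
   a r1 = b r0, the relation "x lies below some leaf of the star of y" (resp.
   "y lies above some leaf of the star of x") between L_1 and L_3 inherits the
   normalized matching inequality.  One more application of Hall's theorem, to
   L_0 + L_1 against L_1 + L_3, then yields the long chains: the stars being
   disjoint, distinct chains use distinct elements of L_2.  When r2 = 1, the
   element of L_2 is comparable to everything and a matching between L_0 and
   L_1 is enough. *)

Require Import Defs.
From mathcomp Require Import all_boot all_order all_algebra.
From mathcomp Require Import zify.

Set Implicit Arguments.
Unset Strict Implicit.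
Unset Printing Implicit Defensive.

Import Order.TTheory GRing.Theory Num.Theory.

(** * Hall's theorem and its version with stars *)

Lemma bigcup_setD (I U : finType) (F : I -> {set U}) (S : {set I})
    (X : {set U}) :
  \bigcup_(i in S) (F i :\: X) = (\bigcup_(i in S) F i) :\: X.
Proof.
apply/setP=> y; rewrite in_setD; apply/bigcupP/andP.
  by case=> i iS /setDP[yF yX]; split=> //; apply/bigcupP; exists i.
by case=> yX /bigcupP[i iS yF]; exists i; rewrite // in_setD yX.
Qed.

(** Induction on the size of [A], according to whether some nonempty proper subset is tight, that
    is, has no more neighbours than elements. The point [y0] supplies a function when [A] is
    empty. *)
Lemma hall (I U : finType) (y0 : U) (N : I -> {set U}) (A : {set I}) :
  (forall S : {set I}, S \subset A -> #|S| <= #|\bigcup_(x in S) N x|) ->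
  exists f : I -> U, {in A &, injective f} /\ {in A, forall x, f x \in N x}.
Proof.
have [n] := ubnP #|A|; elim: n => // n IHn in A N * => ltAn hallA.
have [->|/set0Pn[x xA]] := eqVneq A set0.
  by exists (fun=> y0); split=> x; rewrite inE.
have [tight|/existsPn loose] := boolP [exists S : {set I},
    [&& S \proper A, S != set0 & #|\bigcup_(z in S) N z| <= #|S|]].
  have {tight} [S /and3P[ltSA S0 tight]] := existsP tight.
  have sSA := proper_sub ltSA.
  have [||f [injf fN]] := IHn S N.
  - exact: leq_trans (proper_card ltSA) _.
  - by move=> V sVS; apply: hallA (subset_trans sVS sSA).
  (* The rest of [A] must avoid the neighbours of the tight [S]. Hall's condition survives: [V] and
     [S] together have at least |V| + |S| neighbours, of which at most |S| are neighbours of [S]. *)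
  have [|V sV|g [injg gN]] :=
    IHn (A :\: S) (fun z => N z :\: \bigcup_(t in S) N t).
  - rewrite cardsD (setIidPr sSA).
    by move: S0 (proper_card ltSA); rewrite -card_gt0; lia.
  - have dVS : [disjoint V & S].
      by move: sV; rewrite subsetD => /andP[].
    have sVA : V \subset A by move: sV; rewrite subsetD => /andP[].
    have := hallA (V :|: S); rewrite subUset sVA sSA => /(_ isT).
    rewrite cardsU (disjoint_setI0 dVS) cards0 subn0.
    by rewrite bigcup_setU bigcup_setD cardsU cardsD; lia.
  exists (fun z => if z \in S then f z else g z); split=> [z t zA tA|z zA].
    have fS v : v \in S -> f v \in \bigcup_(t in S) N t.
      by move=> vS; apply/bigcupP; exists v => //; apply: fN.
    have gS v : v \in A -> v \notin S -> g v \notin \bigcup_(t in S) N t.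
      by move=> vA vS; have := gN v; rewrite !inE vA vS => /(_ isT) /andP[].
    case: ifPn => zS; case: ifPn => tS.
    - exact: injf.
    - by move=> E; have := gS t tA tS; rewrite -E fS.
    - by move=> E; have := gS z zA zS; rewrite E fS.
    - by apply: injg; rewrite inE ?zS ?tS.
  case: ifPn => zS; first exact: fN.
  by have := gN z; rewrite !inE zA zS => /(_ isT) /andP[].
(* Without tight sets every nonempty proper subset has a spare neighbour, so [x] may take any
   neighbour [y] and the others can do without it. *)
have [y yx] : exists y, y \in N x.
  apply/set0Pn; rewrite -card_gt0.
  by have := hallA [set x]; rewrite sub1set cards1 big_set1; apply.
have [|S sS|f [injf fN]] := IHn (A :\ x) (fun z => N z :\ y).
- by move: ltAn; rewrite (cardsD1 x A) xA; lia.
- have [->|S0] := eqVneq S set0; first by rewrite cards0.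
  have ltSA : S \proper A by apply: sub_proper_trans sS (properD1 xA).
  have := loose S; rewrite ltSA S0 /= -ltnNge => ltS.
  rewrite bigcup_setD.
  by move: ltS; rewrite (cardsD1 y (\bigcup_(z in S) N z)); lia.
exists (fun z => if z == x then y else f z); split=> [z t zA tA|z zA].
  have fy v : v \in A -> v != x -> f v != y.
    by move=> vA vx; have := fN v; rewrite !inE vA vx => /(_ isT) /andP[].
  case: eqVneq => [->|zx]; case: eqVneq => [->|tx] //.
  - by move=> E; have := fy t tA tx; rewrite -E eqxx.
  - by move=> E; have := fy z zA zx; rewrite E eqxx.
  - by apply: injf; rewrite !inE ?zx ?tx.
case: eqVneq => [->//|zx].
by have := fN z; rewrite !inE zA zx => /(_ isT) /andP[].
Qed.

(** Hall's theorem is applied to [k] copies of each element; [h x] collects the partners of the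
    copies of [x]. *)
Lemma hall_star (I U : finType) (y0 : U) (N : I -> {set U}) (A : {set I}) k :
  (forall S : {set I}, S \subset A -> k * #|S| <= #|\bigcup_(x in S) N x|) ->
  exists h : I -> {set U},
    [/\ {in A, forall x, h x \subset N x},
        {in A &, forall x x' y, y \in h x -> y \in h x' -> x = x'}
      & forall S : {set I}, S \subset A -> #|\bigcup_(x in S) h x| = k * #|S|].
Proof.
move=> hallA.
have [|f [injf fN]] := @hall (I * 'I_k)%type U y0 (fun p => N p.1) (setX A setT).
  move=> S sS; have sSA : [set p.1 | p in S] \subset A.
    apply/subsetP=> _ /imsetP[p /(subsetP sS) + ->].
    by rewrite inE => /andP[].
  (* [S] may contain only some copies of an element; taking all of them keeps the neighbourhood and
     can only increase the size. *)
  apply: leq_trans (_ : #|setX [set p.1 | p in S] [set: 'I_k]| <= _).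
    apply/subset_leq_card/subsetP=> p pS; rewrite !inE andbT.
    exact: imset_f.
  rewrite cardsX cardsT card_ord mulnC; apply: leq_trans (hallA _ sSA) _.
  apply/subset_leq_card/bigcupsP=> _ /imsetP[p pS ->].
  exact: (bigcup_sup p).
have inX x i : x \in A -> (x, i) \in setX A [set: 'I_k] by rewrite !inE andbT.
exists (fun x => [set f (x, i) | i : 'I_k]); split=> [x xA|x x' xA x'A y|S sSA].
- by apply/subsetP=> _ /imsetP[i _ ->]; apply: (fN (x, i)); apply: inX.
- case/imsetP=> i _ -> /imsetP[j _ E].
  by case: (injf _ _ (inX x i xA) (inX x' j x'A) E).
have -> : \bigcup_(x in S) [set f (x, i) | i : 'I_k] = f @: setX S setT.
  apply/setP=> y; apply/bigcupP/imsetP.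
    by case=> x xS /imsetP[i _ ->]; exists (x, i); rewrite ?inE ?xS.
  by case=> -[x i] /setXP[xS _] ->; exists x => //; apply: imset_f.
rewrite card_in_imset; first by rewrite cardsX cardsT card_ord mulnC.
by apply: sub_in2 injf => -[x i] /setXP[/(subsetP sSA) xA _]; apply: inX.
Qed.

(** * Rank in graded posets, and nestings given by labels *)

Lemma rank_lt (d : Order.disp_t) (T : finPOrderType d) (x y : T) :
  graded T -> (x < y)%O -> rank x < rank y.
Proof.
move=> gT ltxy; have [|C mC] := @maxset_exists T (@chain d T) [set x; y].
  apply/chainP; split; first by apply/set0Pn; exists x; rewrite !inE eqxx.
  move=> u v; rewrite !inE => /orP[]/eqP-> /orP[]/eqP->;
    by rewrite ?comparablexx // ?[(y >=< x)%O]comparable_sym lt_comparable.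
rewrite subUset !sub1set => /andP[xC yC].
rewrite (rankE gT mC xC) (rankE gT mC yC); apply: proper_card.
apply/properP; split; last by exists x; rewrite !inE xC ?ltxx.
by apply/subsetP=> u; rewrite !inE => /andP[-> /lt_trans->].
Qed.

Lemma comparable_rank_lt (d : Order.disp_t) (T : finPOrderType d) (x y : T) :
  graded T -> (x >=< y)%O -> rank x < rank y -> (x < y)%O.
Proof.
move=> gT /comparable_ltgtP[//|/(rank_lt gT)|->]; last by rewrite ltnn.
by move=> ltyx ltxy; have := ltn_trans ltyx ltxy; rewrite ltnn.
Qed.

Lemma levelP (d : Order.disp_t) (T : finPOrderType d) (x : T) i :
  reflect (rank x = i) (x \in level T i).
Proof. by rewrite inE; apply: eqP. Qed.

Lemma level_inj (d : Order.disp_t) (T : finPOrderType d) (x : T) i j :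
  x \in level T i -> x \in level T j -> i = j.
Proof. by move=> /levelP<- /levelP<-. Qed.

Lemma lt_levels (d : Order.disp_t) (T : finPOrderType d) i j (x y : T) :
  graded T -> i < j -> x \in level T i -> y \in level T j -> (x >=< y)%O ->
  (x < y)%O.
Proof.
move=> gT ij /levelP xi /levelP yj xy.
by apply: comparable_rank_lt; rewrite ?xi ?yj.
Qed.

(* The rank sets of two fibres are comparable: if [i] is a rank of the first
   only and [j] of the second only, the images of levels [i] and [j] are
   incomparable. *)
Lemma nested_of_key (d : Order.disp_t) (T : finPOrderType d) (K : finType)
    (g : T -> K) :
  graded T -> (forall x y, g x = g y -> (x >=< y)%O) ->
  (forall x y : T, g @: level T (rank x) \subset g @: level T (rank y) \/
               g @: level T (rank y) \subset g @: level T (rank x)) ->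
  nested T.
Proof.
move=> gT cmp tot; exists (preim_partition g [set: T]).
have fibre C : C \in preim_partition g [set: T] ->
    exists x, C = [set y | g x == g y].
  by case/imsetP=> x _ ->; exists x; apply/setP=> y; rewrite !inE.
have sub_or (k l : K) : {subset [seq rank x | x in [set y | k == g y]] <=
      [seq rank x | x in [set y | l == g y]]} \/
    {subset [seq rank x | x in [set y | l == g y]] <=
      [seq rank x | x in [set y | k == g y]]}.
  have [|] := boolP [forall x, (k == g x) ==>
     [exists y, (l == g y) && (rank x == rank y)]].
    move/forallP=> all_kl; left=> _ /imageP[x + ->]; rewrite inE => kx.
    have /existsP[y /andP[ly /eqP->]] := implyP (all_kl x) kx.
    by apply: image_f; rewrite inE.
  rewrite negb_forall => /existsP[x]; rewrite negb_imply => /andP[/eqP kx].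
  rewrite negb_exists => /forallP nox; right=> _ /imageP[y + ->].
  rewrite inE => /eqP ly; have [sxy|syx] := tot x y.
    have /(subsetP sxy)/imsetP[t /levelP<- gxt] : g x \in g @: level T (rank x).
      by apply: imset_f; rewrite inE.
    by apply: image_f; rewrite inE kx gxt.
  have /(subsetP syx)/imsetP[t /levelP tx gyt] : g y \in g @: level T (rank y).
    by apply: imset_f; rewrite inE.
  by have := nox t; rewrite ly gyt tx !eqxx.
(* A fibre is a chain, so rank is injective on it and its list of ranks is as long as the fibre is
   large. *)
have uniq_ranks (k : K) : uniq [seq rank x | x in [set y | k == g y]].
  rewrite map_inj_in_uniq ?enum_uniq // => x y.
  rewrite !mem_enum !inE => /eqP kx /eqP ky rxy; have := cmp x y.
  by rewrite -kx -ky => /(_ erefl)/comparable_ltgtP[/(rank_lt gT)|/(rank_lt gT)|//];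
    rewrite rxy ltnn.
split.
  split; first exact: preim_partitionP.
  move=> C /fibre[x ->]; apply/chainP; split.
    by apply/set0Pn; exists x; rewrite inE.
  move=> u v; rewrite !inE => /eqP xu /eqP xv.
  by apply: cmp; rewrite -xu.
move=> C D /fibre[x ->] /fibre[y ->] leCD.
(* If the inclusion goes the other way, |C| <= |D| forces the two rank sets to be equal. *)
have [//|sDC] := sub_or (g x) (g y).
have [|_ eqDC] := uniq_min_size (uniq_ranks (g y)) sDC; first by rewrite !size_image.
by move=> i; rewrite eqDC.
Qed.

(** Each level has its own labelling, and elements with a common label form one chain. The last
    three hypotheses make the four label sets totally ordered by inclusion. That of level 2 is the
    largest when r2 > 1 and the smallest when r2 = 1, hence the final alternative. *)
Lemma nested_of_keys (d : Order.disp_t) (T : finPOrderType d)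
    (p : nat -> T -> T) :
  graded T -> (forall x : T, rank x <= 3) ->
  (forall i, i <= 3 -> {in level T i &, injective (p i)}) ->
  (forall i j, i < j <= 3 -> forall x y, x \in level T i -> y \in level T j ->
     p i x = p j y -> (x < y)%O) ->
  p 0 @: level T 0 = p 3 @: level T 3 ->
  p 0 @: level T 0 \subset p 1 @: level T 1 \/
  p 1 @: level T 1 \subset p 0 @: level T 0 ->
  (forall i, i <= 3 -> p i @: level T i \subset p 2 @: level T 2) \/
  (forall i, i <= 3 -> p 2 @: level T 2 \subset p i @: level T i) ->
  nested T.
Proof.
move=> gT rank3 injp ltp p03 p01 p2; apply: (@nested_of_key _ _ T (fun x => p (rank x) x)).
- exact: gT.
- move=> x y; have [ltxy|ltyx|eqxy] := ltngtP (rank x) (rank y) => pxy.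
  + apply: lt_comparable; apply: (ltp (rank x) (rank y)) => //.
    * by rewrite ltxy rank3.
    * exact/levelP.
    * exact/levelP.
  + rewrite comparable_sym; apply: lt_comparable.
    apply: (ltp (rank y) (rank x)) => //.
    * by rewrite ltyx rank3.
    * exact/levelP.
    * exact/levelP.
  + suff -> : x = y by rewrite comparablexx.
    by apply: (injp (rank x)); rewrite ?rank3 ?inE ?eqxy // -pxy eqxy.
have pE i : [set p (rank x) x | x in level T i] = p i @: level T i.
  by apply: eq_in_imset => x /levelP->.
move=> x y; rewrite !pE; move: (rank x) (rank y) (rank3 x) (rank3 y) => i j i3 j3.
wlog leij : i j i3 j3 / i <= j.
  by move=> W; have [/W|/ltnW/W] := leqP i j; [apply|move=> /(_ j3 i3) []; [right|left]].
case: p2 => p2.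
- case: (eqVneq j 2) => [->|j2]; first by left; apply: p2.
  case: (eqVneq i 2) => [->|i2]; first by right; apply: p2.
  by case: i j i3 j3 leij i2 j2 => [|[|[|[|i]]]] [|[|[|[|j]]]] //= _ _ _ _ _;
    case: p01 => p01; rewrite -?p03 ?subxx ?p01; by [left | right].
- case: (eqVneq j 2) => [->|j2]; first by right; apply: p2.
  case: (eqVneq i 2) => [->|i2]; first by left; apply: p2.
  by case: i j i3 j3 leij i2 j2 => [|[|[|[|i]]]] [|[|[|[|j]]]] //= _ _ _ _ _;
    case: p01 => p01; rewrite -?p03 ?subxx ?p01; by [left | right].
Qed.

(** * Normalized matching as counting inequalities *)

Lemma GammaP (d : Order.disp_t) (T : finPOrderType d) j (S : {set T}) (y : T) :
  reflect (y \in level T j /\ exists2 x, x \in S & (x >=< y)%O)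
    (y \in Gamma j S).
Proof.
apply: (iffP setIdP) => -[yj].
  by case/exists_inP=> x xS xy; split=> //; exists x; rewrite // comparable_sym.
by case=> x xS xy; split=> //; apply/exists_inP; exists x; rewrite // orbC.
Qed.

Lemma bigcup_Gamma (d : Order.disp_t) (T : finPOrderType d) j (S : {set T}) :
  \bigcup_(x in S) Gamma j [set x] = Gamma j S.
Proof.
apply/setP=> y; apply/bigcupP/GammaP.
  by case=> x xS /GammaP[yj [x']]; rewrite inE => /eqP->; split=> //; exists x.
case=> yj [x xS xy]; exists x => //; apply/GammaP; split=> //.
by exists x; rewrite ?inE.
Qed.

Lemma normalized_matching_nat (d : Order.disp_t) (T : finPOrderType d) i j
    (S : {set T}) :
  normalized_matching T -> i <= poset_rank T -> j <= poset_rank T ->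
  0 < #|level T i| -> 0 < #|level T j| -> S \subset level T i ->
  #|S| * #|level T j| <= #|Gamma j S| * #|level T i|.
Proof.
move=> nmT ir jr i0 j0 /(nmT i j ir jr).
rewrite ler_pdivrMr ?ltr0n // mulrAC ler_pdivlMr ?ltr0n //.
by rewrite -!natrM ler_nat.
Qed.

(** Normalized matching gives |S|(k r_i + 1) <= |Gamma_j(S)| r_i, so a nonempty [S] has strictly
    more than k|S| neighbours and can spare [z]. *)
Lemma star_condition (d : Order.disp_t) (T : finPOrderType d) i j k
    (S : {set T}) (z : T) :
  normalized_matching T -> i <= poset_rank T -> j <= poset_rank T ->
  0 < #|level T i| -> #|level T j| = (k * #|level T i|).+1 ->
  S \subset level T i -> k * #|S| <= #|Gamma j S :\ z|.
Proof.
move=> nmT ir jr i0 jk sS; have [->|S0] := eqVneq S set0.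
  by rewrite cards0 muln0.
have := normalized_matching_nat nmT ir jr i0 _ sS; rewrite jk => /(_ isT).
move: S0; rewrite -card_gt0 (cardsD1 z (Gamma j S)); nia.
Qed.

Lemma bijection_of_card (T : finType) (A B : {set T}) : #|A| = #|B| ->
  exists f : T -> T, {in A &, injective f} /\ f @: A = B.
Proof.
move=> eqAB; have [A0|/set0Pn[x _]] := eqVneq A set0.
  exists id; split=> //; apply/esym/eqP; rewrite imset_id A0 -cards_eq0 -eqAB A0.
  by rewrite cards0.
have [S sS|f [injf fB]] := @hall T T x (fun=> B) A.
  have [->|/set0Pn[y yS]] := eqVneq S set0; first by rewrite cards0.
  apply: leq_trans (subset_leq_card sS) _; rewrite eqAB.
  exact/subset_leq_card/(bigcup_sup y).
exists f; split=> //; apply/eqP; rewrite eqEcard (card_in_imset injf) eqAB leqnn.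
by rewrite andbT; apply/subsetP=> _ /imsetP[u /fB ? ->].
Qed.

Lemma leq_cardU_disjoint (T : finType) (X Y L : {set T}) :
  [disjoint X & Y] -> X \subset L -> Y \subset L -> #|X| + #|Y| <= #|L|.
Proof.
move=> dXY sXL sYL; have := cardsU X Y.
rewrite (disjoint_setI0 dXY) cards0 subn0 => <-.
by rewrite subset_leq_card // subUset sXL.
Qed.

(** Multiply by [s] and split sB as pB + (s - p)B, which is at most sq + (s - p)t; adding sA <= pt
    gives s(t + q). It is used with [p] and [s] the smaller and larger of r0 and r1, to check Hall's
    condition. *)
Lemma weighted_leq_add p s A B t q : 0 < s -> p <= s ->
  B <= t -> s * A <= p * t -> p * B <= s * q -> A + B <= t + q.
Proof.
move=> s0 ps Bt At Bq; rewrite -(leq_pmul2l s0).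
have [k sE] : exists k, s = p + k by exists (s - p); lia.
by rewrite sE in At Bq *; move: (leq_mul (leqnn k) Bt); lia.
Qed.

(** * Level 2 with more than one element *)

Section BigSecondLevel.
Variables (d : Order.disp_t) (T : finPOrderType d) (a b : nat) (z : T).
Hypotheses (gT : graded T) (nmT : normalized_matching T)
  (rankT : poset_rank T = 3) (a_gt0 : 0 < a) (b_gt0 : 0 < b)
  (L0_gt0 : 0 < #|level T 0|) (L1_gt0 : 0 < #|level T 1|)
  (L3E : #|level T 3| = #|level T 0|)
  (zL2 : z \in level T 2)
  (L2a : #|level T 2| = (a * #|level T 1|).+1)
  (L2b : #|level T 2| = (b * #|level T 0|).+1).

Let L := level T.
Let N (x : T) := Gamma 2 [set x] :\ z.

Lemma rank_le3 (x : T) : rank x <= 3.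
Proof. by rewrite -rankT; apply: leq_bigmax. Qed.

Lemma cover_cond1 (S : {set T}) : S \subset L 1 ->
  a * #|S| <= #|Gamma 2 S :\ z|.
Proof. by apply: star_condition; rewrite ?rankT. Qed.

Lemma cover_cond0 (S : {set T}) : S \subset L 0 ->
  b * #|S| <= #|Gamma 2 S :\ z|.
Proof. by apply: star_condition; rewrite ?rankT. Qed.

Lemma cover_cond3 (S : {set T}) : S \subset L 3 ->
  b * #|S| <= #|Gamma 2 S :\ z|.
Proof. by apply: star_condition; rewrite ?rankT ?L3E. Qed.

Lemma cover_sub (S : {set T}) : Gamma 2 S :\ z \subset L 2 :\ z.
Proof. by apply: setSD; apply/subsetP=> x /GammaP[]. Qed.

Lemma card_L2z : #|L 2 :\ z| = b * #|L 0|.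
Proof. by have := cardsD1 z (L 2); rewrite zL2 L2b => -[]. Qed.

Lemma coverP x y : y \in N x -> y \in L 2 /\ (x >=< y)%O.
Proof. by case/setD1P=> _ /GammaP[yL [x']]; rewrite inE => /eqP->. Qed.

Lemma stars (A : {set T}) k :
  (forall S : {set T}, S \subset A -> k * #|S| <= #|Gamma 2 S :\ z|) ->
  exists h : T -> {set T},
    [/\ {in A, forall x, h x \subset N x},
        {in A &, forall x x' y, y \in h x -> y \in h x' -> x = x'}
      & forall S : {set T}, S \subset A -> #|\bigcup_(x in S) h x| = k * #|S|].
Proof.
by move=> kA; apply: (hall_star z) => S sSA; rewrite bigcup_setD bigcup_Gamma; apply: kA.
Qed.

(** Level 1 occurs on both sides, as sources and as targets. Neighbours in levels 1 and 3 are
    counted separately, which is sound because these levels are disjoint. *)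
Lemma hall_levels (E : T -> {set T}) :
  (forall S : {set T}, S \subset L 0 :|: L 1 ->
     #|S :&: L 0| + #|S :\: L 0| <=
       #|(\bigcup_(v in S) E v) :&: L 1| + #|(\bigcup_(v in S) E v) :&: L 3|) ->
  exists m : T -> T, {in L 0 :|: L 1 &, injective m} /\
    {in L 0 :|: L 1, forall v, m v \in E v}.
Proof.
move=> hall_cond; apply: (hall z) => S sS.
rewrite -(cardsID (L 0) S); apply: leq_trans (hall_cond S sS) _.
apply: leq_cardU_disjoint; rewrite ?subsetIl //.
rewrite -setI_eq0; apply/eqP/setP=> x; rewrite !in_setI in_set0.
by apply/negP=> /andP[/andP[_ x1] /andP[_ x3]]; have := level_inj x1 x3.
Qed.

(** The label of an element is the element of level 2 on its chain, level 2 being labelled by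
    itself. Comparisons with level 3 follow by transitivity through the label, so only levels 0 and
    1 need a separate condition. *)
Lemma nested_of_anchors (p0 p1 p3 : T -> T) :
  {in L 0 &, injective p0} -> {in L 1 &, injective p1} ->
  {in L 3 &, injective p3} ->
  {in L 0, forall u, p0 u \in L 2 /\ (u < p0 u)%O} ->
  {in L 1, forall x, p1 x \in L 2 /\ (x < p1 x)%O} ->
  {in L 3, forall y, p3 y \in L 2 /\ (p3 y < y)%O} ->
  {in L 0 & L 1, forall u x, p0 u = p1 x -> (u < x)%O} ->
  {in L 0, forall u, p0 u \in p3 @: L 3} ->
  p0 @: L 0 \subset p1 @: L 1 \/ p1 @: L 1 \subset p0 @: L 0 ->
  nested T.
Proof.
move=> i0 i1 i3 up0 up1 dn3 lt01 s03 s01.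
apply: (@nested_of_keys _ _ (fun i => nth id [:: p0; p1; id; p3] i)) => //.
- exact: rank_le3.
- by case=> [|[|[|[|i]]]] //= _ x y.
- move=> i j /andP[ij j3] x y; case: j i ij j3 => [|[|[|[|j]]]] // [|[|[|i]]] //= _ _ xi yj.
  + exact: lt01.
  + by move=> <-; case: (up0 x xi).
  + by move=> <-; case: (up1 x xi).
  + by move=> E; case: (up0 x xi) => _ /lt_trans; apply; rewrite E; case: (dn3 y yj).
  + by move=> E; case: (up1 x xi) => _ /lt_trans; apply; rewrite E; case: (dn3 y yj).
  + by move=> ->; case: (dn3 y yj).
- apply/eqP; rewrite eqEcard !card_in_imset // L3E leqnn andbT.
  by apply/subsetP=> _ /imsetP[u uL ->]; apply: s03.
left=> -[|[|[|[|i]]]] //= _; rewrite imset_id; apply/subsetP=> _ /imsetP[x xL ->].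
- by case: (up0 x xL).
- by case: (up1 x xL).
- by case: (dn3 x xL).
Qed.

(** This makes the injective matching [m] of Hall's theorem a bijection onto its target levels. *)
Lemma card_L01 : #|L 0 :|: L 1| = #|L 1 :|: L 3|.
Proof.
have dis i j : i != j -> L i :&: L j = set0.
  move=> ij; apply/setP=> x; rewrite in_setI in_set0; apply/negP.
  by case/andP=> xi xj; rewrite (level_inj xi xj) eqxx in ij.
by rewrite !cardsU !dis // addnC [#|L 3|]L3E.
Qed.

Lemma level_matching (S : {set T}) i j : S \subset L i -> i <= 3 -> j <= 3 ->
  0 < #|L i| -> 0 < #|L j| -> #|S| * #|L j| <= #|Gamma j S| * #|L i|.
Proof. by move=> sS i3 j3 i0 j0; apply: normalized_matching_nat; rewrite ?rankT. Qed.

Lemma Gamma1_sub (S : {set T}) (E : T -> {set T}) :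
  {in S :&: L 0, forall u, Gamma 1 [set u] \subset E u} ->
  Gamma 1 (S :&: L 0) \subset (\bigcup_(v in S) E v) :&: L 1.
Proof.
move=> sE; apply/subsetP=> x /GammaP[xL [u uS ux]]; rewrite in_setI xL andbT.
apply/bigcupP; exists u; first by case/setIP: uS.
by apply: (subsetP (sE u uS)); apply/GammaP; split=> //; exists u; rewrite ?inE.
Qed.

(** With [w x] a chosen leaf of the star of [x], each u in level 0 starts the chain u < m u < w (m
    u) < m (m u). An element x of level 1 fixed by [m] only gets x < w x. *)
Lemma nested_r0_le_r1 : #|L 0| <= #|L 1| -> nested T.
Proof.
move=> r01; have [h [hN hinj hcard]] := stars cover_cond1.
have hP x w : x \in L 1 -> w \in h x -> w \in L 2 /\ (x < w)%O.
  move=> xL /(subsetP (hN x xL))/coverP[wL xw]; split=> //.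
  exact: (lt_levels gT (ltnSn 1)).
(* Matching an element of level 1 with itself keeps it out of the chains that
   reach level 3. *)
pose E v := if v \in L 0 then Gamma 1 [set v] else
  v |: [set y in L 3 | [exists w in h v, (w < y)%O]].
have EL0 u : u \in L 0 -> E u = Gamma 1 [set u] by rewrite /E => ->.
have EL1 x : x \in L 1 -> E x = x |: [set y in L 3 | [exists w in h x, (w < y)%O]].
  by rewrite /E; case: ifP => // x0 x1; have := level_inj x0 x1.
have [S sS|m [minj mE]] := @hall_levels E.
  set U := \bigcup_(v in S) E v; set A := S :&: L 0; set B := S :\: L 0.
  have sB : B \subset L 1.
    by rewrite /B subDset.
  have sBU : B \subset U :&: L 1.
    apply/subsetP=> x xB; have xL := subsetP sB x xB.
    rewrite in_setI xL andbT; apply/bigcupP; exists x; last by rewrite EL1 // setU11.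
    by case/setDP: xB.
  have sAU : Gamma 1 A \subset U :&: L 1.
    by apply: Gamma1_sub => u /setIP[_ /EL0->].
  have hA : #|A| * #|L 1| <= #|Gamma 1 A| * #|L 0|.
    by apply: level_matching => //; rewrite subsetIr.
  pose R := L 3 :\: U.
  (* [R] is the part of level 3 missed by [U]. Its neighbours avoid the stars of [B]: a leaf of the
     star of x in [B] below y in [R] would put y in [E x]. Both sets lie in level 2 without [z]. *)
  have hR : b * #|R| + a * #|B| <= b * #|L 0|.
    rewrite -card_L2z -hcard //; apply: leq_trans (leq_add (cover_cond3 _) (leqnn _)) _.
      exact: subsetDl.
    apply: leq_cardU_disjoint; rewrite ?cover_sub //; last first.
      apply/bigcupsP=> x /(subsetP sB)/hN/subset_trans; apply; exact: cover_sub.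
    rewrite -setI_eq0; apply/eqP/setP=> w; rewrite in_setI in_set0; apply/negP.
    case/andP=> /setD1P[_ /GammaP[wL [y yR yw]]] /bigcupP[x xB wx].
    case/setDP: yR => yL /negP[]; apply/bigcupP; exists x; first by case/setDP: xB.
    rewrite EL1 ?(subsetP sB) // !in_setU [y \in [set _ in _ | _]]inE yL.
    apply/orP; right; apply/exists_inP; exists w => //.
    by apply: (lt_levels gT (ltnSn 2)); rewrite // comparable_sym.
  have QR : #|U :&: L 3| + #|R| = #|L 0| by rewrite -L3E -(cardsID U (L 3)) setIC.
  apply: (@weighted_leq_add #|L 0| #|L 1|) => //.
  - exact: subset_leq_card.
  - by rewrite mulnC (leq_trans hA) // mulnC leq_mul2l subset_leq_card ?orbT.
  (* After multiplying by [b], the equality a r1 = b r0 turns [hR] into r0 |B| <= r1 |U :&: L 3|. *)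
  - have e : a * #|L 1| = b * #|L 0| by move: L2a; rewrite L2b => -[].
    rewrite -(leq_pmul2l b_gt0) mulnA -e -mulnA mulnCA.
    rewrite [leqRHS]mulnCA leq_mul2l; apply/orP; right.
    by move: hR; rewrite -QR mulnDr; lia.
have mL0 u : u \in L 0 -> m u \in L 1 /\ (u < m u)%O.
  move=> uL; have := mE u; rewrite in_setU uL EL0 // => /(_ isT).
  case/GammaP=> mL [v]; rewrite inE => /eqP-> um; split=> //.
  exact: (lt_levels gT (ltnSn 0)).
have mL1 x : x \in L 1 ->
    m x = x \/ m x \in L 3 /\ exists2 w, w \in h x & (w < m x)%O.
  move=> xL; have := mE x; rewrite in_setU xL orbT EL1 // => /(_ isT).
  case/setU1P=> [|/setIdP[mL /exists_inP]]; by [left | right].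
(* [m] is onto by cardinality, and it sends level 0 into level 1, so level 3 is reached only from
   level 1. *)
have mim y : y \in L 3 -> exists x, x \in L 1 /\ m x = y.
  have : m @: (L 0 :|: L 1) = L 1 :|: L 3.
    apply/eqP; rewrite eqEcard (card_in_imset minj); apply/andP; split.
      apply/subsetP=> _ /imsetP[v /setUP[vL|vL] ->]; rewrite in_setU.
        by case: (mL0 v vL) => ->.
      by case: (mL1 v vL) => [->|[->]]; rewrite ?vL ?orbT.
    by rewrite card_L01.
  move/setP/(_ y); rewrite in_setU => + yL; rewrite yL orbT.
  case/imsetP=> x /setUP[xL|xL] yE; last by exists x.
  by have [] := mL0 x xL; rewrite -yE => /level_inj/(_ yL).
have [m' m'P] : exists m', forall y, y \in L 3 -> m' y \in L 1 /\ m (m' y) = y.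
  apply: (@fin_all_exists T (fun=> T)
    (fun y x => y \in L 3 -> x \in L 1 /\ m x = y)) => y.
  by have [/mim[x]|] := boolP (y \in L 3); [exists x | exists y].
(* The leaf lies below [m x] when [m x] is in level 3 and is arbitrary otherwise; a leaf exists
   because a > 0. *)
have [w wP] : exists w, forall x, x \in L 1 ->
    w x \in h x /\ (m x \in L 3 -> (w x < m x)%O).
  apply: (@fin_all_exists T (fun=> T) (fun x v =>
    x \in L 1 -> v \in h x /\ (m x \in L 3 -> (v < m x)%O))) => x.
  have [xL|] := boolP (x \in L 1); last by exists x.
  have /set0Pn[w0 w0x] : h x != set0.
    rewrite -card_gt0; have := hcard [set x].
    by rewrite sub1set xL big_set1 cards1 muln1 => ->.
  case: (mL1 x xL) => [mx|[mx [w1 w1x lt1]]]; last by exists w1.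
  by exists w0; split=> //; rewrite mx => /(level_inj xL).
have wL x : x \in L 1 -> w x \in L 2 /\ (x < w x)%O.
  by move=> xL; apply: hP => //; case: (wP x xL).
have winj x x' : x \in L 1 -> x' \in L 1 -> w x = w x' -> x = x'.
  move=> xL x'L e; apply: (hinj x x' xL x'L (w x)); first by case: (wP x xL).
  by rewrite e; case: (wP x' x'L).
apply: (@nested_of_anchors (w \o m) w (w \o m')) => //=.
- move=> u u' uL u'L /winj e; apply: minj; rewrite ?in_setU ?uL ?u'L //.
  by apply: e; [case: (mL0 u uL) | case: (mL0 u' u'L)].
- move=> y y' yL y'L /winj e; have [y1 <-] := m'P y yL; have [y'1 <-] := m'P y' y'L.
  by rewrite e.
- move=> u uL; have [mL um] := mL0 u uL; have [wmL wm] := wL _ mL; split=> //.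
  exact: lt_trans um wm.
- move=> y yL; have [y1 e] := m'P y yL; have [_] := wP _ y1; rewrite e.
  by split; [case: (wL _ y1) | auto].
- move=> u x uL xL /winj e; have [mL um] := mL0 u uL; by rewrite -e.
- move=> u uL; have [mL um] := mL0 u uL.
  (* [m u] is already the image of [u], so by injectivity it is not fixed by [m], and its chain
     reaches level 3. *)
  case: (mL1 _ mL) => [mm|[mm _]].
    have /minj mu : m (m u) = m u by [].
    by move: um; rewrite mu ?ltxx // in_setU ?uL ?mL ?orbT.
  have [m'1 e] := m'P _ mm; apply/imsetP; exists (m (m u)) => //=; congr w.
  by apply/esym/minj; rewrite ?in_setU ?m'1 ?mL ?orbT.
- left; apply/subsetP=> _ /imsetP[u uL ->] /=; apply: imset_f.
  by case: (mL0 u uL).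
Qed.

(** Here [m] sends level 1 into level 3, so level 1 is hit from level 0 only. The chains are u < m u
    < w y < y with y = m (m u), or u < w y < y with y = m u, where [w y] is a leaf of the star of
    y. *)
Lemma nested_r1_le_r0 : #|L 1| <= #|L 0| -> nested T.
Proof.
move=> r10; have [h [hN hinj hcard]] := stars cover_cond3.
have hP y w : y \in L 3 -> w \in h y -> w \in L 2 /\ (w < y)%O.
  move=> yL /(subsetP (hN y yL))/coverP[wL yw]; split=> //.
  by apply: (lt_levels gT (ltnSn 2)); rewrite // comparable_sym.
(* The right-hand copy of level 1 is there to force every element of level 1
   to be covered from below. *)
pose E v := (if v \in L 0 then Gamma 1 [set v] else set0) :|:
  [set y in L 3 | [exists w in h y, (v < w)%O]].
have [S sS|m [minj mE]] := @hall_levels E.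
  set U := \bigcup_(v in S) E v; set A := S :&: L 0; set B := S :\: L 0.
  have sB : B \subset L 1.
    by rewrite /B subDset.
  have sAU : Gamma 1 A \subset U :&: L 1.
    by apply: Gamma1_sub => u /setIP[_ uL]; rewrite /E uL subsetUl.
  have hA : #|A| * #|L 1| <= #|Gamma 1 A| * #|L 0|.
    by apply: level_matching => //; rewrite subsetIr.
  pose R := L 3 :\: U.
  (* A leaf of the star of y in [R] above some x in [C] would put y in [E x]; so the stars of [R]
     avoid the neighbours of [C]. This is used for [C] equal to [A] and to [B]. *)
  have hR (C : {set T}) i : i < 2 -> C \subset S -> C \subset L i ->
      #|Gamma 2 C :\ z| + b * #|R| <= b * #|L 0|.
    move=> i2 sCS sCL; rewrite -card_L2z -hcard ?subsetDl //.
    apply: leq_cardU_disjoint; rewrite ?cover_sub //; last first.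
      by apply/bigcupsP=> y /setDP[/hN/subset_trans + _]; apply; exact: cover_sub.
    rewrite -setI_eq0; apply/eqP/setP=> w; rewrite in_setI in_set0; apply/negP.
    case/andP=> /setD1P[_ /GammaP[wL [x xC xw]]] /bigcupP[y /setDP[yL /negP yU] wy].
    apply: yU; apply/bigcupP; exists x; first exact: (subsetP sCS).
    rewrite in_setU [y \in [set _ in _ | _]]inE yL.
    apply/orP; right; apply/exists_inP; exists w => //.
    exact: (lt_levels gT i2 (subsetP sCL x xC)).
  have QR : #|U :&: L 3| + #|R| = #|L 0| by rewrite -L3E -(cardsID U (L 3)) setIC.
  have AR : b * #|A| + b * #|R| <= b * #|L 0|.
    apply: leq_trans (hR A 0 _ _ _); rewrite ?subsetIl ?subsetIr //.
    by rewrite leq_add2r cover_cond0 ?subsetIr.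
  have BR : a * #|B| + b * #|R| <= b * #|L 0|.
    apply: leq_trans (hR B 1 _ _ _); rewrite ?subsetDl //.
    by rewrite leq_add2r cover_cond1.
  (* Since r1 <= r0 now, levels 0 and 1 exchange their roles in the weighted inequality, and so do
     levels 1 and 3. *)
  rewrite addnC [leqRHS]addnC; apply: (@weighted_leq_add #|L 1| #|L 0|) => //.
  - by move: AR; rewrite -mulnDr leq_pmul2l // -QR leq_add2r.
  - have e : a * #|L 1| = b * #|L 0| by move: L2a; rewrite L2b => -[].
    rewrite -(leq_pmul2l b_gt0) mulnA -e -mulnA mulnCA [leqRHS]mulnCA leq_mul2l.
    by apply/orP; right; move: BR; rewrite -QR mulnDr leq_add2r.
  - by rewrite mulnC (leq_trans hA) // mulnC leq_mul2l subset_leq_card ?orbT.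
have mL0 u : u \in L 0 -> m u \in L 1 /\ (u < m u)%O \/
    m u \in L 3 /\ exists2 w, w \in h (m u) & (u < w)%O.
  move=> uL; have := mE u; rewrite in_setU uL /E uL => /(_ isT).
  case/setUP=> [/GammaP[mL [v]]|/setIdP[mL /exists_inP]]; last by right.
  rewrite inE => /eqP-> um; left; split=> //.
  exact: (lt_levels gT (ltnSn 0)).
have mL1 x : x \in L 1 ->
    m x \in L 3 /\ exists2 w, w \in h (m x) & (x < w)%O.
  move=> xL; have := mE x; rewrite in_setU xL orbT /E ifN; last first.
    by apply/negP=> /level_inj/(_ xL).
  by rewrite set0U => /(_ isT)/setIdP[mL /exists_inP].
have mim y : y \in L 3 -> exists x, [/\ x \in L 0 :|: L 1, m x = y &
    exists2 w, w \in h y & (x < w)%O].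
  have : m @: (L 0 :|: L 1) = L 1 :|: L 3.
    apply/eqP; rewrite eqEcard (card_in_imset minj); apply/andP; split.
      apply/subsetP=> _ /imsetP[v /setUP[vL|vL] ->]; rewrite in_setU.
        by case: (mL0 v vL) => [] [->]; rewrite ?orbT.
      by case: (mL1 v vL) => ->; rewrite orbT.
    by rewrite card_L01.
  move/setP/(_ y); rewrite in_setU => + yL; rewrite yL orbT.
  case/imsetP=> x xL yE; exists x; split=> //; rewrite yE.
  case/setUP: xL => xL; last by case: (mL1 x xL).
  case: (mL0 x xL) => -[mx // _].
  by rewrite -yE in mx; have := level_inj yL mx.
(* [w y] is a leaf of the star of [y] above a preimage of [y] under [m]; by injectivity it is the
   only preimage. *)
have [w wP] : exists w, forall y, y \in L 3 ->
    w y \in h y /\ exists x, [/\ x \in L 0 :|: L 1, m x = y & (x < w y)%O].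
  apply: (@fin_all_exists T (fun=> T) (fun y v => y \in L 3 ->
    v \in h y /\ exists x, [/\ x \in L 0 :|: L 1, m x = y & (x < v)%O])) => y.
  have [/mim|] := boolP (y \in L 3); last by exists y.
  by case=> x [xL mx [w0 w0y xw0]]; exists w0; split=> //; exists x.
have wL y : y \in L 3 -> w y \in L 2 /\ (w y < y)%O.
  by move=> yL; apply: hP => //; case: (wP y yL).
have ltw x : x \in L 0 :|: L 1 -> m x \in L 3 -> (x < w (m x))%O.
  move=> xL mL; have [_ [x' [x'L mx' ltx']]] := wP _ mL.
  by move: ltx'; rewrite (minj _ _ x'L xL mx').
have winj y y' : y \in L 3 -> y' \in L 3 -> w y = w y' -> y = y'.
  move=> yL y'L e; apply: (hinj y y' yL y'L (w y)); first by case: (wP y yL).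
  by rewrite e; case: (wP y' y'L).
have inL0 u : u \in L 0 -> u \in L 0 :|: L 1 by rewrite in_setU => ->.
have inL1 x : x \in L 1 -> x \in L 0 :|: L 1 by rewrite in_setU orbC => ->.
(* The end in level 3 of the chain of [u], reached after one or two applications of [m]. *)
pose top u := if m u \in L 3 then m u else m (m u).
have topP u : u \in L 0 -> top u \in L 3 /\ (u < w (top u))%O.
  move=> uL; rewrite /top; case: ifP => mu; first by split=> //; apply: ltw (inL0 u uL) mu.
  case: (mL0 u uL) => -[mL ltum]; last by rewrite mL in mu.
  have [mmL _] := mL1 _ mL; split=> //; apply: lt_trans ltum _.
  exact: ltw (inL1 _ mL) mmL.
have top1 u x : u \in L 0 -> x \in L 1 -> top u = m x -> m u = x.
  move=> uL xL; rewrite /top; case: (mL0 u uL) => -[mL _].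
    case: ifP => [/(level_inj mL)//|_].
    by apply: minj; apply: inL1.
  rewrite mL => /minj ux; have {}ux : u = x by apply: ux; [exact: inL0|exact: inL1].
  by rewrite ux in uL; have := level_inj uL xL.
have topinj : {in L 0 &, injective top}.
  move=> u u' uL u'L e; apply: minj; [exact: inL0 | exact: inL0 |].
  case: (mL0 u uL) => -[mu _]; case: (mL0 u' u'L) => -[mu' _].
  - by apply: top1 => //; rewrite e /top; case: ifP => // /(level_inj mu').
  - by apply/esym/top1 => //; rewrite -e /top; case: ifP => // /(level_inj mu).
  - by apply: top1 => //; rewrite e /top; case: ifP => // /(level_inj mu').
  - by move: e; rewrite /top mu mu'.
(* As |L 3| = |L 0|, [top] is onto level 3, so every label of level 1 is also a label of level 0. *)
have topim : top @: L 0 = L 3.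
  apply/eqP; rewrite eqEcard (card_in_imset topinj) [#|L 3|]L3E leqnn andbT.
  by apply/subsetP=> _ /imsetP[u uL ->]; case: (topP u uL).
apply: (@nested_of_anchors (w \o top) (w \o m) w) => //=.
- move=> u u' uL u'L /winj e; apply: topinj => //.
  by apply: e; [case: (topP u uL) | case: (topP u' u'L)].
- move=> x x' xL x'L /winj e; apply: minj; [exact: inL1 | exact: inL1 | apply: e].
    by case: (mL1 x xL).
  by case: (mL1 x' x'L).
- by move=> u uL; have [tL lt] := topP u uL; split=> //; case: (wL _ tL).
- move=> x xL; have [mL _] := mL1 x xL.
  by split; [case: (wL _ mL) | apply: ltw (inL1 x xL) mL].
- move=> u x uL xL /winj e; have mu : m u = x.
    apply: top1 => //; apply: e; first by case: (topP u uL).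
    by case: (mL1 x xL).
  case: (mL0 u uL) => -[mL]; rewrite mu // in mL *.
  by have := level_inj xL mL.
- by move=> u uL; apply: imset_f; case: (topP u uL).
right; apply/subsetP=> _ /imsetP[x xL ->] /=.
have [] := mL1 x xL; rewrite -topim => /imsetP[u uL ->] _.
exact: (imset_f (w \o top)).
Qed.

End BigSecondLevel.

(** * Level 2 with a single element, and the theorem *)

Lemma NM_levels (d : Order.disp_t) (T : finPOrderType d) r0 r1 r2 r3 :
  NM T [:: r0; r1; r2; r3] ->
  [/\ poset_rank T = 3, #|level T 0| = r0, #|level T 1| = r1,
      #|level T 2| = r2 & #|level T 3| = r3].
Proof.
case=> _ _; rewrite /rank_numbers => E.
have rT : poset_rank T = 3.
  by move: (congr1 size E); rewrite size_map size_iota => -[].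
by move: E; rewrite rT => -[-> -> -> ->].
Qed.

Lemma nested_singleton_level2 (d : Order.disp_t) (T : finPOrderType d) :
  graded T -> normalized_matching T -> poset_rank T = 3 ->
  0 < #|level T 0| -> 0 < #|level T 1| -> #|level T 3| = #|level T 0| ->
  #|level T 2| = 1 -> nested T.
Proof.
move=> gT nmT rT L0 L1 L3 L2; have [z L2z] : exists z, level T 2 = [set z].
  exact/cards1P/eqP.
have cmpz i x : i <= 3 -> 0 < #|level T i| -> x \in level T i -> (z >=< x)%O.
  (* Normalized matching for {z}, which is all of level 2, forces its neighbourhood in level i to be
     the whole level. *)
  move=> i3 i0 xi; have : level T i \subset Gamma i [set z].
    have := @normalized_matching_nat _ T 2 i [set z] nmT.
    rewrite rT cards1 mul1n L2 muln1 => /(_ isT i3 isT i0).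
    rewrite L2z subxx => /(_ isT) le.
    have/eqP-> // : Gamma i [set z] == level T i.
    by rewrite eqEcard le andbT; apply/subsetP=> y /GammaP[].
  by move/subsetP/(_ x xi)/GammaP=> [_ [y]]; rewrite inE => /eqP->.
have zL : z \in level T 2 by rewrite L2z inE.
have ltz i x : i < 2 -> 0 < #|level T i| -> x \in level T i -> (x < z)%O.
  move=> i2 i0 xi; apply: (lt_levels gT i2 xi zL).
  by rewrite comparable_sym; apply: cmpz xi => //; lia.
have gtz x : x \in level T 3 -> (z < x)%O.
  move=> x3; apply: (lt_levels gT (ltnSn 2) zL x3).
  by apply: (cmpz 3); rewrite ?L3.
(* The smaller of levels 0 and 1 is matched into the larger, and elements of the larger serve as
   labels. [k] is the label of the chain through [z], so it must occur in both levels. *)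
have [p0 [p1 [k [inj0 inj1 lt01 k0 [k1 s01]]]]] : exists (p0 p1 : T -> T) (k : T),
    [/\ {in level T 0 &, injective p0}, {in level T 1 &, injective p1},
        {in level T 0 & level T 1, forall u x, p0 u = p1 x -> (u < x)%O},
        k \in p0 @: level T 0 &
        k \in p1 @: level T 1 /\
        (p0 @: level T 0 \subset p1 @: level T 1 \/
         p1 @: level T 1 \subset p0 @: level T 0)].
  have matching i j : i <= 3 -> j <= 3 -> 0 < #|level T i| ->
      #|level T i| <= #|level T j| ->
      exists f : T -> T, {in level T i &, injective f} /\
        {in level T i, forall x, f x \in level T j /\ (x >=< f x)%O}.
    move=> i3 j3 i0 ij; have [S sS|f [injf fN]] :=
        @hall _ _ z (fun x => Gamma j [set x]) (level T i).
      rewrite bigcup_Gamma.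
      have := normalized_matching_nat nmT _ _ i0 (leq_trans i0 ij) sS.
      rewrite rT => /(_ i3 j3) le; rewrite -(leq_pmul2r i0).
      by apply: leq_trans le; rewrite leq_mul2l ij orbT.
    exists f; split=> // x /fN/GammaP[fx [x']]; rewrite inE => /eqP->.
    by split.
  have [le01|/ltnW le10] := leqP #|level T 0| #|level T 1|.
    have [//|//|//|//|f [injf fP]] := matching 0 1.
    have [u uL] := card_gt0P L0; have f1 v : v \in level T 0 -> f v \in level T 1.
      by move=> /fP[].
    exists f, id, (f u); split=> //.
    - by move=> v x vL xL <-; apply: (lt_levels gT (ltnSn 0) vL (f1 v vL)); case: (fP v vL).
    - exact: imset_f.
    rewrite imset_id; split; first exact: f1.
    by left; apply/subsetP=> _ /imsetP[v vL ->]; apply: f1.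
  have [//|//|//|//|f [injf fP]] := matching 1 0.
  have [x xL] := card_gt0P L1; have f1 v : v \in level T 1 -> f v \in level T 0.
    by move=> /fP[].
  exists id, f, (f x); split=> //.
  - move=> u y uL yL ->; apply: (lt_levels gT (ltnSn 0) (f1 y yL) yL).
    by rewrite comparable_sym; case: (fP y yL).
  - by rewrite imset_id; apply: f1.
  rewrite imset_id; split; first exact: imset_f.
  by right; apply/subsetP=> _ /imsetP[v vL ->]; apply: f1.
(* Any bijection serves, since [z] lies between level 3 and the two lowest levels. *)
have [|p3 [inj3 im3]] := @bijection_of_card T (level T 3) (p0 @: level T 0).
  by rewrite card_in_imset.
apply: (@nested_of_keys _ _ (nth id [:: p0; p1; fun=> k; p3])) => //=.
- by move=> x; rewrite -rT; apply: leq_bigmax.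
- case=> [|[|[|[|i]]]] //= _ x y.
  by rewrite L2z !inE => /eqP-> /eqP->.
- move=> i j /andP[ij j3] x y; case: j i ij j3 => [|[|[|[|j]]]] // [|[|[|i]]] //= _ _ xi yj.
  + exact: lt01.
  + by move=> _; move: yj; rewrite L2z inE => /eqP->; apply: ltz xi.
  + by move=> _; move: yj; rewrite L2z inE => /eqP->; apply: ltz xi.
  + by move=> _; apply: lt_trans (gtz y yj); apply: ltz xi.
  + by move=> _; apply: lt_trans (gtz y yj); apply: ltz xi.
  + by move=> _; move: xi; rewrite L2z inE => /eqP->; apply: gtz.
right=> i i3; rewrite L2z imset_set1 sub1set.
by case: i i3 => [|[|[|[|i]]]] //= _; rewrite ?L2z ?imset_set1 ?inE ?im3.
Qed.

Theorem theorem2p5 (r0 r1 r2 : nat) (d : Order.disp_t) (T : finPOrderType d)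
  (r0_gt0 : 0 < r0) (r1_gt0 : 0 < r1) (r2_gt0 : 0 < r2)
  (TNM : NM T [:: r0; r1; r2; r0])
  (r1_dvd : r1 %| r2 - 1) (r0_dvd : r0 %| r2 - 1) :
  nested T.
Proof.
have [gT nmT _] := TNM; have [rT L0 L1 L2 L3] := NM_levels TNM.
(* For r2 = 1 both quotients [a] and [b] would be 0 and all stars empty. *)
have [r2E|r2_neq1] := eqVneq r2 1.
  by apply: nested_singleton_level2; rewrite ?L0 ?L1 ?L2 ?L3.
have [a aE] := dvdnP r1_dvd; have [b bE] := dvdnP r0_dvd.
have [z zL] : exists z, z \in level T 2 by apply/card_gt0P; rewrite L2.
have a0 : 0 < a by case: a aE => // aE; lia.
have b0 : 0 < b by case: b bE => // bE; lia.
have L2a : #|level T 2| = (a * #|level T 1|).+1 by rewrite L1 L2; lia.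
have L2b : #|level T 2| = (b * #|level T 0|).+1 by rewrite L0 L2; lia.
have L0_gt0 : 0 < #|level T 0| by rewrite L0.
have L1_gt0 : 0 < #|level T 1| by rewrite L1.
have L30 : #|level T 3| = #|level T 0| by rewrite L0.
have [le01|/ltnW le10] := leqP #|level T 0| #|level T 1|.
  exact: (nested_r0_le_r1 gT nmT rT a0 b0 L0_gt0 L1_gt0 L30 zL L2a L2b).
exact: (nested_r1_le_r0 gT nmT rT b0 L0_gt0 L1_gt0 L30 zL L2a L2b).
Qed.
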